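(* There exists a homogeneous polynomial $f\in\mathbb{Q}[x,y,z]$ of degree $4$ defining a smooth Helton-Vinnikov quartic curve such that $f$ has $12$ pairwise inequivalent symmetric linear determinantal representations over the field $\mathbb{Q}$ of rational numbers, that is, representations $f(x,y,z)=\det(Ax+By+Cz)$ with $A,B,C$ symmetric $4\times 4$ matrices with entries in $\mathbb{Q}$.
   Context: Two representations $Ax+By+Cz$ and $A'x+B'y+C'z$ (with $A,B,C,A',B',C'$ symmetric $4\times4$ matrices) are equivalent if there is an invertible complex matrix $U\in\mathrm{GL}_4(\mathbb{C})$ with $U(Ax+By+Cz)U^T=A'x+B'y+C'z$. A Helton-Vinnikov curve is a rigidly convex plane projective curve $\{f=0\}$, $f\in\mathbb{R}[x,y,z]$ homogeneous of degree $d$: it has the maximal number of nested ovals in the real projective plane (for $d=4$: two nested ovals). Equivalently, $f$ is hyperbolic: there is a point $e\in\mathbb{R}^3$ with $f(e)\neq 0$ such that for every $v\in\mathbb{R}^3\setminus\{0\}$ the univariate polynomial $f(v+te)\in\mathbb{R}[t]$ has only real zeros. Smooth means that the complex projective curve defined by $f$ in $\mathbb{P}^2_{\mathbb{C}}$ is smooth. *)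

(* Defs.v *)
From mathcomp Require Import all_boot all_order all_algebra.
From mathcomp Require Import complex mpoly reals.

Set Implicit Arguments.
Unset Strict Implicit.
Unset Printing Implicit Defensive.

Import Order.TTheory GRing.Theory Num.Theory.
Local Open Scope ring_scope.
Local Open Scope complex_scope.

(* The triple (A, B, C) of coefficient matrices is a map M : 'I_3 -> 'M_d, and
   the variables x, y, z are 'X_0, 'X_1, 'X_2, so [pencil M] is Ax + By + Cz. *)
Definition pencil (K : comNzRingType) (d : nat) (M : 'I_3 -> 'M[K]_d) :
    'M[{mpoly K[3]}]_d :=
  \sum_k 'X_k *: map_mx (@mpolyC 3 K) (M k).

Definition sym_det_rep (K : comNzRingType) (d : nat) (f : {mpoly K[3]})
    (M : 'I_3 -> 'M[K]_d) : Prop :=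
  (forall k, (M k)^T = M k) /\ f = \det (pencil M).

Definition equiv_rep (K : comUnitRingType) (d : nat)
    (M M' : 'I_3 -> 'M[K]_d) : Prop :=
  exists2 U : 'M[K]_d, U \in unitmx &
    map_mx (@mpolyC 3 K) U *m pencil M *m (map_mx (@mpolyC 3 K) U)^T
      = pencil M'.

(* Jacobian criterion; intended for K algebraically closed and f homogeneous. *)
Definition smooth_plane_curve (K : fieldType) (f : {mpoly K[3]}) : Prop :=
  forall p : 'I_3 -> K, (exists i, p i != 0) -> f.@[p] = 0 ->
    exists i, (mderiv i f).@[p] != 0.

(* The univariate polynomial f(v + t e) in the indeterminate t. *)
Definition line_restr (K : comNzRingType) (f : {mpoly K[3]})
    (v e : 'I_3 -> K) : {poly K} :=
  mmap (@polyC K) (fun i => (v i)%:P + 'X * (e i)%:P) f.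

Definition real_rooted (R : rcfType) (p : {poly R}) : Prop :=
  forall z : R[i], root (map_poly (real_complex R) p) z -> complex.Im z = 0.

(* Rigid convexity (the Helton-Vinnikov condition), as hyperbolicity. *)
Definition hyperbolic (R : rcfType) (f : {mpoly R[3]}) : Prop :=
  exists e : 'I_3 -> R, f.@[e] != 0 /\
    forall v : 'I_3 -> R, (exists i, v i != 0) ->
      real_rooted (line_restr f v e).

(* Main.v *)
Require Import Defs.
From Stdlib Require Import BinInt.
From mathcomp Require Import ssrZ.
From mathcomp Require Import all_boot all_order all_algebra.
From mathcomp Require Import complex mpoly reals.
From mathcomp Require Import ring.
Set Implicit Arguments.
Unset Strict Implicit.
Unset Printing Implicit Defensive.
Import Order.TTheory GRing.Theory Num.Theory.
Local Open Scope ring_scope.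
Local Open Scope complex_scope.

(** The theorem holds because of an explicit quartic,
      f = 9 (49 x^4 - 562 x^2 y^2 + 1089 y^4 - 130 x^2 z^2 + 562 y^2 z^2 + 81 z^4),
    together with twelve symmetric pencils of integer matrices of determinant f.

    Over the complex numbers the classes of symmetric determinantal
    representations of a smooth quartic correspond to its 36 even theta
    characteristics, and 12 of these are real when the curve has two nested
    ovals.  For f all of those 12 come from rational matrices.  The first
    pencil below defines a net of quadrics in P^3 whose eight base points (a
    Cayley octad) form four conjugate pairs over Q(sqrt(-2)).  The other 35
    classes correspond to the partitions of the octad into two sets of four, and
    eleven of these are stable under conjugation.  Each of the eleven gives a
    class over Q(sqrt(-2)) that is stable under conjugation and, for this f,
    contains a rational representation.

    The resulting matrices are checked directly.  As f is a quadratic form q in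
    x^2, y^2, z^2, its curve is smooth because the conic q = 0 is smooth and is in
    general position with respect to the coordinate triangle
    ([transversal_conic], [quartic_smooth]).  On a line with direction (1, 0, 0)
    the polynomial f is biquadratic in x with nonnegative discriminant, whence
    hyperbolicity ([real_biquadratic], [quartic_hyperbolic]).  The determinants
    are ring identities ([reps_represent]).  Inequivalence is detected by one
    number, the trace of M(r)^-1 M(q) M(p)^-1 M(q) for three fixed points
    p, q, r: it is unchanged by M |-> U M U^T ([cross_trace_congr]) and takes
    twelve different values ([uniq_zcross]). *)

Delimit Scope Z_scope with zZ.
(* Integer coefficients remain literals, which [ring] recognises. *)
Arguments int_of_Z : simpl never.

Local Notation "z %:zr" := ((int_of_Z z)%:~R) (at level 2, format "z %:zr").

Lemma zr_neq0 (K : numFieldType) z : z != 0%zZ -> z%:zr != 0 :> K.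
Proof. by rewrite intr_eq0; apply: contra => /eqP z0; rewrite -[z]int_of_ZK z0. Qed.

(** * The quartic *)

(** The square factor 9 makes all twelve representations integral. *)
Definition quartic (S : comNzRingType) (x y z : S) : S :=
  9 * (49 * x ^+ 4 - 562 * (x ^+ 2 * y ^+ 2) + 1089 * y ^+ 4
       - 130 * (x ^+ 2 * z ^+ 2) + 562 * (y ^+ 2 * z ^+ 2) + 81 * z ^+ 4).

Lemma rmorph_quartic (S T : comNzRingType) (g : {rmorphism S -> T}) x y z :
  g (quartic x y z) = quartic (g x) (g y) (g z).
Proof. by rewrite /quartic; ring. Qed.

Definition quartic_mpoly (K : comNzRingType) : {mpoly K[3]} :=
  quartic 'X_0 'X_1 'X_2%R.

Lemma map_quartic_mpoly (K : numFieldType) :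
  map_mpoly (@ratr K) (quartic_mpoly rat) = quartic_mpoly K.
Proof. by rewrite /quartic_mpoly rmorph_quartic /= !map_mpolyX. Qed.

Lemma quartic_homog (K : comNzRingType) : quartic_mpoly K \is 4.-homog.
Proof.
have hX (i : 'I_3) m : ('X_i : {mpoly K[3]}) ^+ m \is m.-homog.
  by rewrite -[m in m.-homog]mul1n; apply: dhomogMn; rewrite dhomogX; exact/eqP/mdeg1.
have hXX (i j : 'I_3) : ('X_i : {mpoly K[3]}) ^+ 2 * 'X_j ^+ 2 \is 4.-homog.
  exact: (dhomogM (hX i 2%N) (hX j 2%N)).
have hn n (p : {mpoly K[3]}) : p \is 4.-homog -> n%:R * p \is 4.-homog.
  by move=> hp; rewrite mulr_natl rpredMn.
apply: (hn).
refine (rpredD (rpredD (rpredB (rpredD (rpredB (hn _ _ _) (hn _ _ _)) (hn _ _ _))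
  (hn _ _ _)) (hn _ _ _)) (hn _ _ _)).
- exact: hX.
- exact: hXX.
- exact: hX.
- exact: hXX.
- exact: hXX.
- exact: hX.
Qed.

(** * Smoothness *)

(** A point where all three products vanish satisfies, for some set I of
    indices, X_i = 0 off I and the linear equations indexed by I.  The
    determinant of the latter is a principal minor of the Gram matrix of the
    conic, and all principal minors are nonzero: the conic is smooth, avoids the
    vertices of the coordinate triangle and is tangent to none of its sides. *)
Lemma transversal_conic (K : fieldType) (a b c d e f X Y Z : K) :
  a != 0 -> b != 0 -> c != 0 ->
  a * b - d ^+ 2 != 0 -> a * c - e ^+ 2 != 0 -> b * c - f ^+ 2 != 0 ->
  a * (b * c - f ^+ 2) - d * (d * c - e * f) + e * (d * f - b * e) != 0 ->
  X * (a * X + d * Y + e * Z) = 0 -> Y * (d * X + b * Y + f * Z) = 0 ->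
  Z * (e * X + f * Y + c * Z) = 0 -> [/\ X = 0, Y = 0 & Z = 0].
Proof.
move=> a0 b0 c0 ab ac bc abc.
have cancel u v w : u != 0 -> u * v = w -> w = 0 -> v = 0 :> K.
  by move=> u0 uv w0; apply: (mulfI u0); rewrite uv w0 mulr0.
move=> /eqP; rewrite mulf_eq0 => /orP[]/eqP x1 /eqP;
  rewrite mulf_eq0 => /orP[]/eqP x2 /eqP; rewrite mulf_eq0 => /orP[]/eqP x3.
- by [].
- split=> //; apply: (cancel c _ _ c0 _ x3); rewrite x1 x2; ring.
- split=> //; apply: (cancel b _ _ b0 _ x2); rewrite x1 x3; ring.
- have p2 : b * Y + f * Z = 0 by rewrite -x2 x1; ring.
  have p3 : f * Y + c * Z = 0 by rewrite -x3 x1; ring.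
  split=> //; apply: (cancel _ _ _ bc (erefl _)).
    by transitivity (c * (b * Y + f * Z) - f * (f * Y + c * Z)); [ring | rewrite p2 p3; ring].
  by transitivity (b * (f * Y + c * Z) - f * (b * Y + f * Z)); [ring | rewrite p2 p3; ring].
- split=> //; apply: (cancel a _ _ a0 _ x1); rewrite x2 x3; ring.
- have p1 : a * X + e * Z = 0 by rewrite -x1 x2; ring.
  have p3 : e * X + c * Z = 0 by rewrite -x3 x2; ring.
  split=> //; apply: (cancel _ _ _ ac (erefl _)).
    by transitivity (c * (a * X + e * Z) - e * (e * X + c * Z)); [ring | rewrite p1 p3; ring].
  by transitivity (a * (e * X + c * Z) - e * (a * X + e * Z)); [ring | rewrite p1 p3; ring].
- have p1 : a * X + d * Y = 0 by rewrite -x1 x3; ring.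
  have p2 : d * X + b * Y = 0 by rewrite -x2 x3; ring.
  split=> //; apply: (cancel _ _ _ ab (erefl _)).
    by transitivity (b * (a * X + d * Y) - d * (d * X + b * Y)); [ring | rewrite p1 p2; ring].
  by transitivity (a * (d * X + b * Y) - d * (a * X + d * Y)); [ring | rewrite p1 p2; ring].
(* The rows of the adjugate matrix eliminate two variables at a time. *)
set l1 := _ + _ + _ in x1; set l2 := _ + _ + _ in x2; set l3 := _ + _ + _ in x3.
split; apply: (cancel _ _ _ abc (erefl _)).
- transitivity ((b * c - f ^+ 2) * l1 + (e * f - d * c) * l2 + (d * f - b * e) * l3).
    by rewrite /l1 /l2 /l3; ring.
  by rewrite x1 x2 x3; ring.
- transitivity ((e * f - d * c) * l1 + (a * c - e ^+ 2) * l2 + (d * e - a * f) * l3).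
    by rewrite /l1 /l2 /l3; ring.
  by rewrite x1 x2 x3; ring.
- transitivity ((d * f - b * e) * l1 + (d * e - a * f) * l2 + (a * b - d ^+ 2) * l3).
    by rewrite /l1 /l2 /l3; ring.
  by rewrite x1 x2 x3; ring.
Qed.

Lemma mderiv_var (K : nzRingType) n (i j : 'I_n) :
  mderiv i ('X_j : {mpoly K[n]}) = (i == j)%:R.
Proof.
rewrite mderivX mnm1E eq_sym; case: eqP => [->|_]; last by rewrite scale0r.
by rewrite scale1r -{1}[U_(j)%MM]addm0 addmC addmK mpolyX0.
Qed.

Lemma quartic_mderiv (K : comNzRingType) (p : 'I_3 -> K) (i : 'I_3) :
  let X := p 0 in let Y := p 1 in let Z := p 2%R in
  (mderiv i (quartic_mpoly K)).@[p] = 36 *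
  ((i == 0)%:R * (X * (49 * X ^+ 2 - 281 * Y ^+ 2 - 65 * Z ^+ 2))
   + (i == 1)%:R * (Y * (1089 * Y ^+ 2 - 281 * X ^+ 2 + 281 * Z ^+ 2))
   + (i == 2%R)%:R * (Z * (81 * Z ^+ 2 - 65 * X ^+ 2 + 281 * Y ^+ 2))).
Proof.
move=> X Y Z.
have Dn n (q : {mpoly K[3]}) : mderiv i (n%:R * q) = n%:R * mderiv i q.
  by rewrite !mulr_natl mderivMn.
have D2 (j : 'I_3) : mderiv i ('X_j ^+ 2 : {mpoly K[3]}) = 2%:R * 'X_j * (i == j)%:R.
  by rewrite expr2 mderivM mderiv_var; ring.
have D4 (j : 'I_3) : mderiv i ('X_j ^+ 4 : {mpoly K[3]}) = 4%:R * 'X_j ^+ 3 * (i == j)%:R.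
  by rewrite -[4%N]/(2 + 2)%N exprD mderivM D2; ring.
have D22 (j k : 'I_3) : mderiv i ('X_j ^+ 2 * 'X_k ^+ 2 : {mpoly K[3]}) =
    2%:R * 'X_j * (i == j)%:R * 'X_k ^+ 2 + 'X_j ^+ 2 * (2%:R * 'X_k * (i == k)%:R).
  by rewrite mderivM !D2.
rewrite /quartic_mpoly /quartic Dn !mderivD !mderivN !Dn !D22 !D4.
rewrite /X /Y /Z -!(mevalXU p).
ring.
Qed.

(** In terms of X = x^2, Y = y^2, Z = z^2, the expressions x f_x, y f_y, z f_z
    are multiples of the three products to which [transversal_conic] applies. *)
Lemma quartic_smooth (K : numFieldType) : smooth_plane_curve (quartic_mpoly K).
Proof.
move=> p [i0 pi0] _; apply/existsP; apply: contraT; rewrite negb_exists => /forallP dp.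
have {}dp i : (mderiv i (quartic_mpoly K)).@[p] = 0 by apply/eqP; have := dp i; rewrite negbK.
have nz n : n.+1%:R != 0 :> K by rewrite pnatr_eq0.
have d0 (u v w : K) : 36 * u = 0 -> v = w * u -> v = 0.
  by move=> /eqP; rewrite mulf_eq0 (negPf (nz 35)) => /eqP-> ->; rewrite mulr0.
have nzE (u : K) z : z != 0%zZ -> u = z%:zr -> u != 0 by move=> z0 ->; apply: zr_neq0.
set X := p 0; set Y := p 1; set Z := p 2%R.
have dX := dp 0; have dY := dp 1; have dZ := dp 2%R.
move: dX dY dZ; rewrite !quartic_mderiv !eqxx /= -/X -/Y -/Z => dX dY dZ.
have [] := @transversal_conic K 49 1089 81 (- 281) (- 65) 281 (X ^+ 2) (Y ^+ 2) (Z ^+ 2).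
- exact: nz.
- exact: nz.
- exact: nz.
(* The principal minors of order 2 and 3. *)
- by apply: (nzE _ (- 25600)%zZ) => //; ring.
- by apply: (nzE _ (- 256)%zZ) => //; ring.
- by apply: (nzE _ 9248%zZ) => //; ring.
- by apply: (nzE _ (- 278784)%zZ) => //; ring.
- by apply: (d0 _ _ X dX); ring.
- by apply: (d0 _ _ Y dY); ring.
- by apply: (d0 _ _ Z dZ); ring.
move=> /eqP; rewrite sqrf_eq0 => /eqP x0 /eqP; rewrite sqrf_eq0 => /eqP y0 /eqP.
rewrite sqrf_eq0 => /eqP z0; case/eqP: pi0; rewrite -[RHS]x0.
case: i0 => [[|[|[|k]]] ki] //; [rewrite /X | rewrite x0 -[RHS]y0 /Y | rewrite x0 -[RHS]z0 /Z];
  by congr (p _); apply: val_inj.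
Qed.

(** * Hyperbolicity *)

(** The two values of a x^2 are h - s and h + s with s^2 = h^2 - a g.  Both are
    real because h^2 >= a g, and nonnegative because a g >= 0 gives s <= h. *)
Lemma real_biquadratic (R : rcfType) (a h g : R) (x : R[i]) :
  0 < a -> 0 <= h -> 0 <= g -> a * g <= h ^+ 2 ->
  a%:C * x ^+ 4 - 2 * h%:C * x ^+ 2 + g%:C = 0 -> complex.Im x = 0.
Proof.
move=> a0 h0 g0 agh x0.
have root_real (u : R) : 0 <= u -> a%:C * x ^+ 2 = u%:C -> complex.Im x = 0.
  move=> u0 xu; pose r := Num.sqrt (u / a).
  have r2 : a * r ^+ 2 = u.
    by rewrite sqr_sqrtr; [rewrite mulrC divfK ?gt_eqF | rewrite divr_ge0 // ltW].
  have aC : a%:C != 0 :> R[i] by rewrite fmorph_eq0 gt_eqF.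
  have : (x - r%:C) * (x + r%:C) = 0.
    by apply: (mulfI aC); transitivity (a%:C * x ^+ 2 - (a * r ^+ 2)%:C);
      [ring | rewrite r2 xu; ring].
  by move=> /eqP; rewrite mulf_eq0 subr_eq0 addr_eq0 => /orP[]/eqP -> /=; rewrite ?oppr0.
pose s := Num.sqrt (h ^+ 2 - a * g).
have s2 : s ^+ 2 = h ^+ 2 - a * g by rewrite sqr_sqrtr ?subr_ge0.
have s0 : 0 <= s := sqrtr_ge0 _.
have sh : s <= h by rewrite -ler_sqr ?nnegrE // s2 gerBl mulr_ge0 // ltW.
have : (a%:C * x ^+ 2 - (h - s)%:C) * (a%:C * x ^+ 2 - (h + s)%:C) = 0.
  transitivity (a%:C * (a%:C * x ^+ 4 - 2 * h%:C * x ^+ 2) + (h ^+ 2 - s ^+ 2)%:C).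
    ring.
  by rewrite s2 -[RHS](mulr0 a%:C) -x0; ring.
move=> /eqP; rewrite mulf_eq0 !subr_eq0 => /orP[]/eqP; apply: root_real.
  by rewrite subr_ge0.
exact: addr_ge0.
Qed.

Lemma real_quartic (R : rcfType) (x : R[i]) (b c : R) :
  quartic x b%:C c%:C = 0 -> complex.Im x = 0.
Proof.
move=> x0.
have pos (k l m : nat) : 0 <= k%:R * b ^+ 4 + l%:R * (b ^+ 2 * c ^+ 2) + m%:R * c ^+ 4.
  have p4 (u : R) : 0 <= u ^+ 4 by apply: exprn_even_ge0.
  by do 2?[apply: addr_ge0]; apply: mulr_ge0; rewrite ?ler0n ?p4 // mulr_ge0 ?sqr_ge0.
apply: (@real_biquadratic R 49 (281 * b ^+ 2 + 65 * c ^+ 2)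
  (1089 * b ^+ 4 + 562 * (b ^+ 2 * c ^+ 2) + 81 * c ^+ 4)) => //.
- by apply: addr_ge0; apply: mulr_ge0; rewrite ?ler0n ?sqr_ge0.
(* h^2 - a g = 32 (800 b^4 + 281 b^2 c^2 + 8 c^4). *)
- have := pos 800%N 281%N 8%N.
  rewrite -subr_ge0 => D0; rewrite -subr_ge0.
  set u := (X in 0 <= X); suff -> : u = 32 * (800 * b ^+ 4 + 281 * (b ^+ 2 * c ^+ 2) + 8 * c ^+ 4).
    by rewrite mulr_ge0.
  by rewrite /u; ring.
have n9 : 9 != 0 :> R[i] by rewrite pnatr_eq0.
apply: (mulfI n9); rewrite mulr0 -[RHS]x0 /quartic; ring.
Qed.

Lemma quartic_hyperbolic (R : rcfType) : hyperbolic (quartic_mpoly R).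
Proof.
exists (fun i => (i == 0)%:R); split.
  rewrite /quartic_mpoly rmorph_quartic /= !mevalXU /= /quartic.
  have -> : 9 * (49 * 1 ^+ 4 - 562 * (1 ^+ 2 * 0 ^+ 2) + 1089 * 0 ^+ 4
    - 130 * (1 ^+ 2 * 0 ^+ 2) + 562 * (0 ^+ 2 * 0 ^+ 2) + 81 * 0 ^+ 4) = 441%zZ%:zr :> R.
    by ring.
  by rewrite intr_eq0.
move=> v _ z; rewrite /root /line_restr /quartic_mpoly.
rewrite rmorph_quartic /= !mmapX !mmap1U /=.
rewrite rmorph_quartic !rmorphD !rmorphM /= !map_polyC map_polyX /=.
rewrite -[_.[z]]/(horner_eval z _) rmorph_quartic /= /horner_eval !hornerE.
move=> /eqP/real_quartic.
by case: z => zr zi /=; rewrite add0r.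
Qed.

(** * Twelve rational representations *)

(** A symmetric 4 x 4 matrix of linear forms a x + b y + c z with integer
    coefficients is stored as the list of the triples (a, b, c) on and above the
    diagonal, row by row. *)
Definition entries := seq (Z * Z * Z).

Definition tri_index (i j : nat) : nat :=
  nth 0 (nth [::] [:: [:: 0; 1; 2; 3]; [:: 1; 4; 5; 6]; [:: 2; 5; 7; 8];
                      [:: 3; 6; 8; 9]] i) j.

Definition entry (t : entries) (i j : nat) : Z * Z * Z :=
  nth (0, 0, 0)%zZ t (tri_index i j).

Definition coord (v : Z * Z * Z) (k : nat) : Z :=
  nth 0%zZ [:: v.1.1; v.1.2; v.2] k.

(** The reflections y |-> -y and z |-> -z preserve the quartic, so that they
    carry representations to representations. *)
Definition neg_y (t : entries) : entries := [seq (v.1.1, - v.1.2, v.2) | v <- t].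
Definition neg_z (t : entries) : entries := [seq (v.1.1, v.1.2, - v.2) | v <- t].

Definition base_reps : seq entries := ([::
  [:: (32, 2, 0); (-1, 17, 0); (0, 0, 3); (0, 0, 6);
      (2, -4, 0); (0, 0, -3); (0, 0, 3);
      (4, 4, 0); (-3, 3, 0);
      (4, -6, 0)] ;
  [:: (18, -18, 0); (0, 0, -3); (-3, 15, 0); (0, 0, -9);
      (2, 2, 0); (0, 0, 3); (1, 5, 0);
      (4, 4, 0); (0, 0, 0);
      (4, -4, 0)] ;
  [:: (-2, -3, -1); (2, -4, 3); (1, 2, 1); (2, 3, -2);
      (-3, 3, 0); (2, -4, 0); (6, -12, -6);
      (1, 4, 3); (-4, -9, 4);
      (-3, 0, -3)] ;
  [:: (-3, -3, 0); (0, 0, -3); (-1, -1, -3); (-4, -10, 0);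
      (-3, 3, 0); (5, -1, -1); (-4, 2, -16);
      (-4, -22, -2); (3, 7, -7);
      (1, 12, -9)] ;
  [:: (8, -12, 0); (0, 2, -3); (2, 0, 3); (-1, 1, 3);
      (4, -5, 3); (1, -2, 3); (1, -10, 0);
      (6, 9, 3); (0, -1, 3);
      (3, -2, -3)] ;
  [:: (-9, 9, 0); (-3, -3, 6); (0, 12, 0); (3, -3, 3);
      (2, 1, -3); (1, -3, -1); (-1, -7, -1);
      (-2, -2, 0); (4, 0, 4);
      (-2, 0, -2)] ;
  [:: (3, -3, 0); (0, 0, -3); (0, 6, 1); (0, 0, 0);
      (3, 3, 0); (-1, 5, 0); (0, 12, 0);
      (10, 3, 9); (3, -7, 9);
      (6, -6, 0)] ;
  [:: (-9, 0, 9); (-3, 0, 3); (0, 9, 0); (0, 9, 0);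
      (-3, 0, -1); (0, 3, 0); (-1, -8, -1);
      (-1, 0, -1); (-1, 0, -5);
      (-26, -11, 15)]
  ])%zZ.

(** The last four of the eight representations above have mirror images that
    are not equivalent to them, under y |-> -y for three of them and under
    z |-> -z for the fourth. *)
Definition reps : seq entries :=
  base_reps ++ [seq neg_y t | t <- take 3 (drop 4 base_reps)]
            ++ [seq neg_z t | t <- drop 7 base_reps].

Definition zmx (S : pzRingType) (a : nat -> nat -> Z) : 'M[S]_4 :=
  \matrix_(i, j) (a i j)%:zr.

Definition rep (S : pzRingType) (t : entries) (k : 'I_3) : 'M[S]_4 :=
  zmx S (fun i j => coord (entry t i j) k).

Lemma rep_tr (S : pzRingType) t k : (rep S t k)^T = rep S t k.
Proof.
apply/matrixP => i j; rewrite !mxE; congr (_%:~R); congr (int_of_Z (coord _ _)).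
by case: i j => [[|[|[|[|i]]]] // ?] [[|[|[|[|j]]]] // ?].
Qed.

(** First-row expansion of a determinant, written so that it can be unfolded to
    a polynomial in the entries and evaluated on integers. *)
Fixpoint laplace (S : comNzRingType) (n : nat) (a : nat -> nat -> S) : S :=
  if n isn't m.+1 then 1 else
  foldr (fun j s => (-1) ^+ j * a 0%N j * laplace m (fun k l => a k.+1 (bump j l)) + s)
    0 (iota 0 n).

Lemma det_laplace (S : comNzRingType) n (a : nat -> nat -> S) :
  \det (\matrix_(i < n, j < n) a i j) = laplace n a.
Proof.
elim: n a => [|n IHn] a; first by rewrite det_mx00.
rewrite (expand_det_row _ ord0).
transitivity (\sum_(j <- iota 0 n.+1)
    (-1) ^+ j * a 0%N j * laplace n (fun k l => a k.+1 (bump j l))); last by rewrite unlock.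
rewrite -[iota 0 n.+1]/(index_iota 0 n.+1) big_mkord.
apply: eq_bigr => j _; rewrite mxE /cofactor add0n -IHn mulrCA mulrA.
by congr (_ * \det _); apply/matrixP => k l; rewrite !mxE.
Qed.

Definition linear_form (S : comNzRingType) (x y z : S) (v : Z * Z * Z) : S :=
  v.1.1%:zr * x + v.1.2%:zr * y + v.2%:zr * z.

Lemma nth_neg_y t k : let v := nth (0, 0, 0)%zZ t k in
  nth (0, 0, 0)%zZ (neg_y t) k = (v.1.1, - v.1.2, v.2).
Proof. by elim: t k => [|v t IHt] [|k] //=. Qed.

Lemma nth_neg_z t k : let v := nth (0, 0, 0)%zZ t k in
  nth (0, 0, 0)%zZ (neg_z t) k = (v.1.1, v.1.2, - v.2).
Proof. by elim: t k => [|v t IHt] [|k] //=. Qed.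

(** The same expansion for a symmetric matrix given by its entries on and above
    the diagonal; m1, ..., m6 are the 2 x 2 minors of its last two rows. *)
Definition symdet4 (S : comNzRingType) (q : nat -> S) : S :=
  let m1 := q 7%N * q 9%N - q 8%N * q 8%N in
  let m2 := q 5%N * q 9%N - q 8%N * q 6%N in
  let m3 := q 5%N * q 8%N - q 7%N * q 6%N in
  let m4 := q 2%N * q 9%N - q 8%N * q 3%N in
  let m5 := q 2%N * q 8%N - q 7%N * q 3%N in
  let m6 := q 2%N * q 6%N - q 5%N * q 3%N in
  q 0%N * (q 4%N * m1 - q 5%N * m2 + q 6%N * m3) - q 1%N * (q 1%N * m1 - q 5%N * m4 + q 6%N * m5)
  + q 2%N * (q 1%N * m2 - q 4%N * m4 + q 6%N * m6) - q 3%N * (q 1%N * m3 - q 4%N * m5 + q 5%N * m6).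

Lemma laplace_symdet4 (S : comNzRingType) (q : nat -> S) :
  laplace 4 (fun i j => q (tri_index i j)) = symdet4 q.
Proof.
rewrite /laplace /= /bump /= !(add0n, add1n) /tri_index /= /symdet4.
ring.
Qed.

Definition represents (t : entries) : Prop := forall (S : comNzRingType) (x y z : S),
  symdet4 (fun k => linear_form x y z (nth (0, 0, 0)%zZ t k)) = quartic x y z.

Lemma base_reps_represent t : t \in base_reps -> represents t.
Proof.
rewrite /base_reps !inE => tP S x y z; rewrite /symdet4 /quartic.
by move: tP; do 7? [case/orP]; move/eqP=> ->; rewrite /linear_form /=; ring.
Qed.

Lemma neg_y_represents t : represents t -> represents (neg_y t).
Proof.
move=> tP S x y z; transitivity (quartic x (- y) z); last by rewrite /quartic; ring.
by rewrite -tP /symdet4 !nth_neg_y /linear_form /=; ring.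
Qed.

Lemma neg_z_represents t : represents t -> represents (neg_z t).
Proof.
move=> tP S x y z; transitivity (quartic x y (- z)); last by rewrite /quartic; ring.
by rewrite -tP /symdet4 !nth_neg_z /linear_form /=; ring.
Qed.

Lemma reps_represent t : t \in reps -> represents t.
Proof.
rewrite /reps !mem_cat => /or3P[|/mapP[u uP ->]|/mapP[u uP ->]].
- exact: base_reps_represent.
- by apply/neg_y_represents/base_reps_represent; apply/(mem_drop (n0 := 4))/(mem_take uP).
- by apply/neg_z_represents/base_reps_represent; apply/(mem_drop uP).
Qed.

Lemma sum_ord3 (V : nmodType) (F : 'I_3 -> V) :
  \sum_k F k = F 0 + F 1 + F 2%R.
Proof.
rewrite !big_ord_recl big_ord0 addr0 addrA.
by congr (F _ + F _ + F _); apply: val_inj.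
Qed.

Lemma det_pencil_rep (K : comNzRingType) t :
  represents t -> \det (pencil (rep K t)) = quartic_mpoly K.
Proof.
move=> tP; rewrite /quartic_mpoly -tP -laplace_symdet4 -det_laplace.
congr (\det _); apply/matrixP => i j.
rewrite /pencil sum_ord3 !mxE /linear_form /entry.
by rewrite !rmorph_int ![_%:~R * 'X_ _]mulrC.
Qed.

(** * Inequivalence *)

Definition pencil_at (K : comNzRingType) (n : nat) (M : 'I_3 -> 'M[K]_n) (p : 'I_3 -> K) :
    'M[K]_n := \sum_k p k *: M k.

Lemma meval_pencil (K : comNzRingType) n (M : 'I_3 -> 'M[K]_n) (p : 'I_3 -> K) :
  map_mx (meval p) (pencil M) = pencil_at M p.
Proof.
apply/matrixP => i j; rewrite /pencil /pencil_at !sum_ord3 !mxE.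
by rewrite !(mevalD, mevalM, mevalXU, mevalC).
Qed.

Lemma equiv_rep_at (K : comUnitRingType) n (M M' : 'I_3 -> 'M[K]_n) :
  equiv_rep M M' -> exists2 U : 'M[K]_n, U \in unitmx &
    forall p, U *m pencil_at M p *m U^T = pencil_at M' p.
Proof.
case=> U uU UM; exists U => // p; rewrite -!meval_pencil -UM !map_mxM -map_trmx.
suff -> : map_mx (meval p) (map_mx (@mpolyC 3 K) U) = U by [].
by apply/matrixP => i j; rewrite !mxE; exact: mevalC.
Qed.

Lemma invmx_eq (K : comUnitRingType) n (A B : 'M[K]_n) :
  A *m B = 1%:M -> invmx A = B.
Proof.
by move=> AB; have [uA _] := mulmx1_unit AB; rewrite -[B](mulKmx uA) AB mulmx1.
Qed.

(** The trace of P^-1 Q alone does not distinguish representations M: for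
    P = M(p) and Q = M(q) it is the logarithmic derivative of f at p in the
    direction q.  With inverses taken at two different points the trace is no
    longer determined by f. *)
Definition cross_trace (K : comUnitRingType) n (P Q R : 'M[K]_n) : K :=
  \tr (invmx R *m Q *m (invmx P *m Q)).

Lemma cross_trace_congr (K : comUnitRingType) n (U P Q R : 'M[K]_n) :
  U \in unitmx -> P \in unitmx -> R \in unitmx ->
  cross_trace (U *m P *m U^T) (U *m Q *m U^T) (U *m R *m U^T) = cross_trace P Q R.
Proof.
move=> uU uP uR; have uT : U^T \in unitmx by rewrite unitmx_tr.
have invC X : X \in unitmx ->
    invmx (U *m X *m U^T) = invmx U^T *m invmx X *m invmx U.
  by move=> uX; apply: invmx_eq; rewrite !mulmxA !mulmxK // mulmxV.
rewrite /cross_trace !invC // !mulmxA !mulmxKV // mulmxK // mxtrace_mulC !mulmxA.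
by rewrite mulmxV // mul1mx.
Qed.

Definition zmul (a b : nat -> nat -> Z) (i j : nat) : Z :=
  a i 0%N * b 0%N j + a i 1%N * b 1%N j + a i 2%N * b 2%N j + a i 3%N * b 3%N j.

Definition ztrace (a : nat -> nat -> Z) : Z :=
  a 0%N 0%N + a 1%N 1%N + a 2%N 2%N + a 3%N 3%N.

Definition zadj (a : nat -> nat -> Z) (i j : nat) : Z :=
  (-1) ^+ (i + j) * laplace 3 (fun k l => a (bump j k) (bump i l)).

Definition zat (t : entries) (p : Z * Z * Z) (i j : nat) : Z :=
  let v := entry t i j in p.1.1 * v.1.1 + p.1.2 * v.1.2 + p.2 * v.2.

Definition zpoint (K : comNzRingType) (p : Z * Z * Z) (k : 'I_3) : K := (coord p k)%:zr.

Lemma zmxM (K : comNzRingType) a b : zmx K (zmul a b) = zmx K a *m zmx K b.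
Proof.
apply/matrixP => i j; rewrite !mxE !big_ord_recl big_ord0 addr0 !mxE /zmul /=.
by rewrite !addrA !rmorphD !rmorphM.
Qed.

Lemma zmx_trace (K : comNzRingType) a : \tr (zmx K a) = (ztrace a)%:zr.
Proof.
rewrite /mxtrace !big_ord_recl big_ord0 addr0 !mxE /ztrace /=.
by rewrite !addrA !rmorphD.
Qed.

Lemma pencil_at_rep (K : comNzRingType) t p :
  pencil_at (rep K t) (zpoint K p) = zmx K (zat t p).
Proof.
apply/matrixP => i j; rewrite /pencil_at sum_ord3 !mxE /zat /zpoint.
by rewrite !rmorphD !rmorphM.
Qed.

Definition zadj_spec (a : nat -> nat -> Z) (c : Z) : bool :=
  all (fun i => all (fun j => zmul a (zadj a) i j == (if i == j then c else 0)) (iota 0 4))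
    (iota 0 4).

Lemma zmx_inv (K : fieldType) a c : zadj_spec a c -> c%:zr != 0 :> K ->
  zmx K a \in unitmx /\ invmx (zmx K a) = (c%:zr)^-1 *: zmx K (zadj a).
Proof.
move=> /allP aP c0.
have mem4 (k : 'I_4) : (k : nat) \in iota 0 4 by rewrite mem_iota ltn_ord.
have ac : zmx K a *m ((c%:zr)^-1 *: zmx K (zadj a)) = 1%:M.
  apply/matrixP => i j; rewrite -scalemxAr -zmxM !mxE.
  have /eqP -> := allP (aP i (mem4 i)) j (mem4 j).
  by rewrite -val_eqE; case: ifP => _; rewrite ?mulVf ?mulr0.
by split; [have [] := mulmx1_unit ac | exact: invmx_eq].
Qed.

(** [cross_trace] at the points p = (1, 1, 0), q = (0, 0, 1), r = (1, 0, 2), up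
    to the common factor f(p) f(r): adjugates replace the inverses, so that the
    value is an integer. *)
Definition zcross (t : entries) : Z :=
  ztrace (zmul (zmul (zadj (zat t (1, 0, 2)%zZ)) (zat t (0, 0, 1)%zZ))
               (zmul (zadj (zat t (1, 1, 0)%zZ)) (zat t (0, 0, 1)%zZ))).

(** The constants are f(1, 0, 2) and f(1, 1, 0).  They do not vanish, so the
    matrices of all twelve pencils are invertible at these two points. *)
Lemma reps_adj : all (fun t => zadj_spec (zat t (1, 0, 2)%zZ) 7425%zZ
  && zadj_spec (zat t (1, 1, 0)%zZ) 5184%zZ) reps.
Proof. by vm_compute. Qed.

Lemma uniq_zcross : uniq [seq zcross t | t <- reps].
Proof. by vm_compute. Qed.

Lemma cross_trace_rep (K : numFieldType) t : t \in reps ->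
  let P := zmx K (zat t (1, 1, 0)%zZ) in
  let R := zmx K (zat t (1, 0, 2)%zZ) in
  [/\ P \in unitmx, R \in unitmx &
      cross_trace P (zmx K (zat t (0, 0, 1)%zZ)) R
        = ((7425%zZ)%:zr)^-1 * ((5184%zZ)%:zr)^-1 * (zcross t)%:zr].
Proof.
move=> /(allP reps_adj)/andP[tR tP] P R.
have [uR RE] := @zmx_inv K _ _ tR (zr_neq0 K (z := 7425%zZ) isT).
have [uP PE] := @zmx_inv K _ _ tP (zr_neq0 K (z := 5184%zZ) isT).
split=> //; rewrite /cross_trace PE RE -!scalemxAl -scalemxAr scalerA -!zmxM.
by rewrite mxtraceZ zmx_trace.
Qed.

Lemma reps_inequiv (K : numFieldType) t u : t \in reps -> u \in reps ->
  equiv_rep (rep K t) (rep K u) -> zcross t = zcross u.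
Proof.
move=> tP uP /equiv_rep_at[U uU tu].
have tuz p : U *m zmx K (zat t p) *m U^T = zmx K (zat u p) by rewrite -!pencil_at_rep.
have [tP1 tR1 tE] := cross_trace_rep K tP.
have [_ _ uE] := cross_trace_rep K uP.
move: uE; rewrite -!tuz cross_trace_congr // tE.
move/mulfI => /(_ _)/intr_inj/(can_inj int_of_ZK); apply.
by rewrite mulf_neq0 // invr_eq0 intr_eq0.
Qed.

(** * The theorem *)

Lemma pencil_map_rep (K : numFieldType) t :
  pencil (fun k => map_mx (@ratr K) (rep rat t k)) = pencil (rep K t).
Proof.
apply: eq_bigr => k _; congr (_ *: map_mx _ _).
by apply/matrixP => i j; rewrite !mxE ratr_int.
Qed.

Theorem mainTheorem2 (R : realType) :
  exists f : {mpoly rat[3]},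
    [/\ f \is 4.-homog,
        smooth_plane_curve (map_mpoly (@ratr R[i]) f),
        hyperbolic (map_mpoly (@ratr R) f) &
        exists M : 'I_12 -> 'I_3 -> 'M[rat]_4,
          (forall a, sym_det_rep f (M a)) /\
          (forall a b, a != b ->
             ~ equiv_rep (fun k => map_mx (@ratr R[i]) (M a k))
                         (fun k => map_mx (@ratr R[i]) (M b k)))].
Proof.
exists (quartic_mpoly rat); split.
- exact: quartic_homog.
- by rewrite map_quartic_mpoly; exact: quartic_smooth.
- by rewrite map_quartic_mpoly; exact: quartic_hyperbolic.
have repsP (a : 'I_12) : nth [::] reps a \in reps by rewrite mem_nth.
exists (fun a => rep rat (nth [::] reps a)); split=> [a | a b].
  split; first exact: rep_tr.
  by rewrite det_pencil_rep //; exact: reps_represent.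
apply: contra_neq_not; rewrite /equiv_rep !pencil_map_rep => ab.
have {}ab := reps_inequiv (repsP a) (repsP b) ab.
apply/val_inj/eqP; rewrite -(nth_uniq 0%zZ _ _ uniq_zcross) ?size_map;
  try exact: ltn_ord.
by rewrite !(nth_map [::]); try exact: ltn_ord; apply/eqP.
Qed.
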